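(* Let $H$ be a fixed graph with at least one edge. Then there exist a constant $\alpha > 0$ and a sequence of $n$-vertex graphs $G_n$ (indexed by the positive integers $n$ divisible by $|H|$) with minimum degree $\delta(G_n) \geq \alpha n$, such that whenever $p = p(n)$ satisfies $p = o(n^{-1/d^*(H)})$, asymptotically almost surely $G_n \cup G_{n,p}$ does not contain a perfect $H$-tiling.
   Context: All graphs are finite and simple. For a graph $H$, $|H|$ denotes its number of vertices and $e(H)$ its number of edges. For a graph $H$ on at least two vertices, $d(H) := \frac{e(H)}{|H|-1}$ and $d^*(H) := \max\{ d(H') : H' \subseteq H,\ |H'| \geq 2\}$, the maximum being over all subgraphs $H'$ of $H$ with at least two vertices. An $H$-tiling in a graph $G$ is a collection of vertex-disjoint copies of $H$ in $G$ (copies are not necessarily induced); it is perfect if it covers all vertices of $G$. An $n$-vertex graph is assumed to have vertex set $[n] = \{1,\dots,n\}$. $G_{n,p}$ is the Erdős–Rényi random graph on vertex set $[n]$ in which each edge is present with probability $p \in [0,1]$, independently of all other choices. If $G$ and $G'$ are $n$-vertex graphs, $G \cup G'$ is the (simple) graph on $[n]$ with edge set $E(G) \cup E(G')$. ''Asymptotically almost surely'' means with probability tending to $1$ as $n \to \infty$ (through multiples of $|H|$). *)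

(* Defs.v *)
From HB Require Import structures.
From mathcomp Require Import all_boot all_order all_algebra.
From mathcomp Require Import all_classical all_reals all_analysis.

Set Implicit Arguments.
Unset Strict Implicit.
Unset Printing Implicit Defensive.

Import Order.TTheory GRing.Theory Num.Theory.
Import numFieldNormedType.Exports.

Local Open Scope ring_scope.

Record sgraph (V : finType) := SGraph {
  edges : {set {set V}};
  card_edge : [forall e in edges, #|e| == 2%N] }.

HB.instance Definition _ (V : finType) := [isSub for @edges V].
HB.instance Definition _ (V : finType) := [Finite of sgraph V by <:].

Section Graphs.
Variable V : finType.
Implicit Types G : sgraph V.

Lemma gunion_proof G G' : [forall e in edges G :|: edges G', #|e| == 2%N].
Proof.
apply/forall_inP => e; rewrite inE => /orP[].
  exact: (forall_inP (card_edge G)).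
exact: (forall_inP (card_edge G')).
Qed.

Definition gunion G G' : sgraph V := SGraph (gunion_proof G G').

Definition degree G (v : V) : nat := #|[set u | [set u; v] \in edges G]|.

(* The neutral element #|V| is never attained by a degree, so this is the true
   minimum as soon as V is nonempty. *)
Definition min_degree G : nat := \big[minn/#|V|]_(v : V) degree G v.

(* A pair (W, F) encodes the graph with vertex set W and edge set F. *)
Definition subgraph G (S : {set V} * {set {set V}}) : bool :=
  (S.2 \subset edges G) && [forall e in S.2, e \subset S.1].

Variable R : realType.

Definition density (S : {set V} * {set {set V}}) : R :=
  #|S.2|%:R / (#|S.1|%:R - 1).

(* The densities are nonnegative, so the default value 0 is harmless. *)
Definition dstar G : R :=
  \big[Num.max/0]_(S | subgraph G S && (2 <= #|S.1|)%N) density S.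

End Graphs.

Section Tilings.
Variables (W V : finType) (H : sgraph W) (G : sgraph V).

Definition is_copy (S : {set V} * {set {set V}}) : bool :=
  subgraph G S &&
  [exists f : {ffun W -> V},
    [&& injectiveb f, S.1 == f @: [set: W]
      & S.2 == [set f @: (e : {set W}) | e in edges H]]].

Definition tiling (T : {set {set V} * {set {set V}}}) : bool :=
  [forall S in T, is_copy S] &&
  [forall S in T, forall S' in T, (S != S') ==> [disjoint S.1 & S'.1]].

Definition perfect (T : {set {set V} * {set {set V}}}) : bool :=
  \bigcup_(S in T) S.1 == [set: V].

Definition has_perfect_tiling : bool := [exists T, tiling T && perfect T].

End Tilings.

Section RandomGraph.
Variables (R : realType) (n : nat) (p : R).

(* The product over all potential edges expresses their independence. *)
Definition Gnp_mass (G : sgraph 'I_n) : R :=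
  \prod_(e : {set 'I_n} | #|e| == 2%N) (if e \in edges G then p else 1 - p).

Definition Gnp_prob (A : pred (sgraph 'I_n)) : R := \sum_(G | A G) Gnp_mass G.

End RandomGraph.

(* The filter "n tends to infinity through multiples of h". *)
Definition multiples (h : nat) : set_system nat :=
  within [set n | (h %| n)%N]%classic \oo%classic.

#[global] Instance multiples_filter (h : nat) : Filter (multiples h).
Proof. exact: within_filter. Qed.

(* Main.v *)
(* Let m = n / |H| and let A be a set of about m / 2 vertices. The graph G_n of
   all pairs meeting A has minimum degree at least |A|. A perfect H-tiling has m
   copies, of which at most |A| meet A; the remaining ones, about m / 2, use no
   edge of G_n, hence lie in G_{n,p}. Let S be a subgraph of H with v vertices
   and k edges of maximal density k / (v - 1) = d*(H). Restricting these copies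
   to S gives about m / 2 copies of S in G_{n,p}, whereas their expected number
   is at most n^v p^k = n (n^{1/d*} p)^k = o(n), so by Markov's
   inequality this happens with probability o(1). *)
Require Import Defs.
From mathcomp Require Import all_boot all_order all_algebra.
From mathcomp Require Import all_classical all_reals all_analysis.
From mathcomp Require Import ring zify.
Set Implicit Arguments.
Unset Strict Implicit.
Unset Printing Implicit Defensive.
Import Order.TTheory GRing.Theory Num.Theory.
Import numFieldNormedType.Exports.
Local Open Scope ring_scope.

(** * Cardinalities and images of finite sets *)

(** Picking a related [y] for each [x] gives an injection. The relational form suits tiles, which
    are counted below by vertices of [A] or by placements, neither of them canonical. *)
Lemma leq_card_rel (T1 T2 : finType) (A : {set T1}) (B : {set T2})
    (r : T1 -> T2 -> bool) :
  (forall x, x \in A -> exists2 y, y \in B & r x y) ->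
  (forall x x' y, x \in A -> x' \in A -> r x y -> r x' y -> x = x') ->
  (#|A| <= #|B|)%N.
Proof.
move=> rex runiq; pose f x := [pick y in B | r x y].
have fP x : x \in A -> exists y, [/\ f x = Some y, y \in B & r x y].
  move=> /rex[y yB rxy]; rewrite /f; case: pickP => [z /andP[zB rxz]|/(_ y)].
    by exists z.
  by rewrite yB rxy.
rewrite -(card_in_imset (f := f)) => [|x x' xA x'A].
  rewrite -(card_imset (f := @Some T2) B) => [|? ? []//].
  apply/subset_leq_card/fintype.subsetP => _ /imsetP[x xA ->].
  by have [y [-> yB _]] := fP _ xA; apply: imset_f.
have [y [-> _ rxy]] := fP _ xA; have [y' [-> _ rxy']] := fP _ x'A.
by case=> eyy'; apply: runiq rxy _ => //; rewrite eyy'.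
Qed.

Lemma imset_inj_in (aT rT : finType) (f : aT -> rT) (A B C : {set aT}) :
  {in A &, injective f} -> B \subset A -> C \subset A ->
  f @: B = f @: C -> B = C.
Proof.
move=> finj.
have sub (B' C' : {set aT}) : B' \subset A -> C' \subset A ->
    f @: B' = f @: C' -> B' \subset C'.
  move=> /fintype.subsetP sB /fintype.subsetP sC eBC.
  apply/fintype.subsetP => x xB.
  have /imsetP[y yC exy] : f x \in f @: C' by rewrite -eBC imset_f.
  by rewrite (finj _ _ (sB _ xB) (sC _ yC) exy).
move=> sB sC eBC; apply/eqP; rewrite finset.eqEsubset.
by apply/andP; split; apply: sub.
Qed.

(** * Containment probabilities and a first-moment bound *)

Section RandomGraph.
Variables (R : realType) (n : nat) (p : R).
Hypothesis p01 : 0 <= p <= 1.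

Lemma Gnp_mass_ge0 (G : sgraph 'I_n) : 0 <= Gnp_mass p G.
Proof.
have /andP[p0 p1] := p01.
by apply: prodr_ge0 => e _; case: ifP; rewrite // subr_ge0.
Qed.

(* Expanding the product, over all pairs e, of the two contributions of e, one
   gets the sum of the masses of the graphs that contain D. *)
Lemma Gnp_prob_sub (D : {set {set 'I_n}}) :
  (forall e, e \in D -> #|e| == 2%N) ->
  Gnp_prob p [pred G | D \subset edges G] = p ^+ #|D|.
Proof.
move=> D2.
(* [F] is the factor of [e] when present, [F'] when absent. Their zeros kill every [J] that contains
   a non-pair or misses an element of [D]. *)
pose F (e : {set 'I_n}) : R := if #|e| == 2%N then p else 0.
pose F' (e : {set 'I_n}) : R :=
  if #|e| == 2%N then (if e \in D then 0 else 1 - p) else 1.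
pose P (J : {set {set 'I_n}}) :=
  [forall e in J, #|e| == 2%N] && (D \subset J).
have -> : p ^+ #|D| = \prod_e (F e + F' e).
  rewrite -prodr_const (bigID (mem D) predT) /= [X in _ = _ * X]big1 ?mulr1.
    by apply: eq_bigr => e eD; rewrite /F /F' D2 // eD addr0.
  move=> e /negbTE eD; rewrite /F /F' eD.
  by case: ifP => _; rewrite ?add0r // addrC subrK.
rewrite bigA_distr /= /Gnp_prob.
rewrite [RHS](bigID P) /= [X in _ = _ + X]big1 ?addr0; last first.
  move=> J /nandP[/forall_inPn[e eJ e2]|/subsetPn[e eD eJ]].
    by rewrite (bigD1 e) //= eJ /F (negbTE e2) mul0r.
  by rewrite (bigD1 e) //= (negbTE eJ) /F' D2 // eD mul0r.
rewrite [RHS](reindex_omap (@edges _) insub) /=; last first.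
  by move=> J /andP[J2 _]; rewrite insubT.
apply: eq_big => [G|G DG].
  by rewrite valK eqxx /P (card_edge G) andbT.
rewrite /Gnp_mass big_mkcond /=; apply: eq_bigr => e _.
rewrite /F /F'; case: (boolP (e \in edges G)) => eG.
  by rewrite (forall_inP (card_edge G)).
case: ifP => // _; case: ifP => // eD.
by rewrite (fintype.subsetP DG) in eG.
Qed.

Lemma Gnp_probC (A : pred (sgraph 'I_n)) :
  Gnp_prob p [pred G | ~~ A G] = 1 - Gnp_prob p A.
Proof.
(* Taking [D] empty shows that the total mass is 1. *)
have : forall e : {set 'I_n}, e \in finset.set0 -> #|e| == 2%N.
  by move=> e; rewrite inE.
move=> /Gnp_prob_sub; rewrite cards0 expr0.
rewrite /Gnp_prob (bigID A) /= => <-.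
have sub0 (P : pred (sgraph 'I_n)) :
    \sum_(G | (finset.set0 \subset edges G) && P G) Gnp_mass p G =
    \sum_(G | P G) Gnp_mass p G.
  by apply: eq_bigl => G; rewrite finset.sub0set.
by rewrite !sub0 addrAC subrr add0r.
Qed.

Lemma Gnp_prob_ge0 (A : pred (sgraph 'I_n)) : 0 <= Gnp_prob p A.
Proof. by apply: sumr_ge0 => G _; exact: Gnp_mass_ge0. Qed.

(** Markov's inequality for the number of [t] in [A] with [D t] contained in the random graph: by
    linearity its expectation is the right-hand side. *)
Lemma Gnp_prob_markov (T : finType) (A : {set T}) (D : T -> {set {set 'I_n}})
    (k c : nat) (B : pred (sgraph 'I_n)) :
  (forall t e, t \in A -> e \in D t -> #|e| == 2%N) ->
  (forall t, t \in A -> #|D t| = k) ->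
  (forall G, B G -> (c <= #|[set t in A | D t \subset edges G]|)%N) ->
  c%:R * Gnp_prob p B <= #|A|%:R * p ^+ k.
Proof.
move=> D2 Dk cB.
have -> : #|A|%:R * p ^+ k =
    \sum_(G : sgraph 'I_n)
      #|[set t in A | D t \subset edges G]|%:R * Gnp_mass p G.
  transitivity (\sum_(t in A) Gnp_prob p [pred G | D t \subset edges G]).
    rewrite mulr_natl -sumr_const; apply: eq_bigr => t tA.
    by rewrite Gnp_prob_sub ?Dk // => e; apply: D2.
  rewrite /Gnp_prob; under eq_bigr do rewrite big_mkcond.
  rewrite exchange_big; apply: eq_bigr => G _ /=.
  rewrite mulr_natl -sumr_const -big_mkcondr /=.
  by apply: eq_bigl => t; rewrite inE.
rewrite /Gnp_prob mulr_sumr [leRHS](bigID B) /= -[leLHS]addr0.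
apply: lerD; last by apply: sumr_ge0 => G _; rewrite mulr_ge0 ?Gnp_mass_ge0.
by apply: ler_sum => G BG; rewrite ler_wpM2r ?Gnp_mass_ge0 // ler_nat cB.
Qed.

End RandomGraph.

(** * The graph of all pairs meeting a given set *)

Section HittingGraph.
Variables (V : finType) (A : {set V}).

Lemma hitting_graph_proof :
  [forall e in [set e : {set V} | (#|e| == 2%N) && ~~ [disjoint e & A]],
     #|e| == 2%N].
Proof. by apply/forall_inP => e; rewrite inE => /andP[]. Qed.

Definition hitting_graph : sgraph V := SGraph hitting_graph_proof.

Lemma hitting_graph_min_degree :
  (#|A| < #|V|)%N -> (#|A| <= min_degree hitting_graph)%N.
Proof.
move=> AV; rewrite /min_degree; elim/big_ind: _ => [|x y|v _].
- exact: ltnW.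
- by rewrite leq_min => -> ->.
have deg u : u != v -> (u \in A) || (v \in A) ->
    u \in [set u | [set u; v] \in edges hitting_graph].
  move=> uv uvA; rewrite !inE cards2 uv /=; apply/negP => /pred0P dis.
  by case/orP: uvA => wA; [have := dis u | have := dis v];
     rewrite /= !inE wA eqxx ?orbT.
(* A vertex of [A] is adjacent to all [#|V| - 1] others, hence the strict hypothesis; a vertex
   outside [A] is adjacent to all of [A]. *)
rewrite /degree; have [vA|vA] := boolP (v \in A).
  have : (#|A| <= #|finset.setC [set v]|)%N.
    by rewrite cardsC1 -ltnS prednK ?(leq_trans _ AV).
  move/leq_trans; apply; apply/subset_leq_card/fintype.subsetP => u.
  by rewrite finset.in_setC1 => uv; apply: deg; rewrite ?vA ?orbT.
apply/subset_leq_card/fintype.subsetP => u uA; apply: deg; last by rewrite uA.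
by apply: contraNneq vA => <-.
Qed.

End HittingGraph.

(** * From perfect tilings to placements of a subgraph [S] of [H] *)

Section Placements.
Variables (W V : finType) (H : sgraph W) (S : {set W} * {set {set W}}).
Variables (x0 : W) (y0 : V).
Hypotheses (subS : subgraph H S) (x0S : x0 \in S.1).

(* An injection S.1 -> V, extended by the constant y0 outside of S.1. *)
Definition placements : {set {ffun W -> V}} :=
  [set g in pffun_on y0 S.1 predT | dinjectiveb g S.1].

Definition placed_edges (g : {ffun W -> V}) : {set {set V}} :=
  [set g @: (e : {set W}) | e in S.2].

Lemma card_placements : (#|placements| <= #|V| ^ #|S.1|)%N.
Proof.
have <- : #|pffun_on y0 S.1 (@predT V)| = (#|V| ^ #|S.1|)%N.
  exact: card_pffun_on.
by apply/subset_leq_card/fintype.subsetP => g; rewrite inE => /andP[].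
Qed.

Lemma placement_inj g : g \in placements -> {in S.1 &, injective g}.
Proof. by rewrite inE => /andP[_ /dinjectiveP]. Qed.

Lemma subgraph_edge_sub e : e \in S.2 -> e \subset S.1.
Proof. by case/andP: subS => _ /forall_inP; apply. Qed.

Lemma card_placed_edges g : g \in placements -> #|placed_edges g| = #|S.2|.
Proof.
move=> /placement_inj ginj; apply: card_in_imset => e e' eS e'S.
by apply: imset_inj_in ginj _ _; exact: subgraph_edge_sub.
Qed.

Lemma placed_edge_card2 g e :
  g \in placements -> e \in placed_edges g -> #|e| == 2%N.
Proof.
move=> /placement_inj ginj /imsetP[e' e'S ->].
case/andP: (subS) => /fintype.subsetP sub _.
rewrite card_in_imset ?(forall_inP (card_edge H)) ?sub // => x y xe ye.
by apply: ginj; apply: (fintype.subsetP (subgraph_edge_sub e'S)).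
Qed.

(** Disjointness allows at most [#|A|] tiles to meet [A], and each other tile yields its own
    placement of [S] in [G]; each tile covers [#|W|] vertices. *)
Lemma tiling_placements (A : {set V}) (G : sgraph V) :
  has_perfect_tiling H (gunion (hitting_graph A) G) ->
  (#|V| <= #|W| *
     (#|A| + #|[set g in placements | placed_edges g \subset edges G]|))%N.
Proof.
case/existsP => T /andP[/andP[/forall_inP Tcopy /forall_inP Tdis] /eqP Tcov].
have disT X Y y : X \in T -> Y \in T -> y \in X.1 -> y \in Y.1 -> X = Y.
  move=> XT YT yX yY; apply/eqP; apply: contraTT isT => XY.
  have := implyP (forall_inP (Tdis _ XT) _ YT) XY.
  by move=> /pred0P/(_ y); rewrite /= yX yY.
pose T1 := [set X in T | ~~ [disjoint X.1 & A]].
pose T2 := [set X in T | [disjoint X.1 & A]].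
have T1A : (#|T1| <= #|A|)%N.
  pose r1 (X : {set V} * {set {set V}}) (y : V) := y \in X.1.
  apply: (leq_card_rel (r := r1)) => [X|X Y y].
    rewrite inE => /andP[_ /pred0Pn[y /andP[yX yA]]].
    by exists y.
  by rewrite !inE => /andP[XT _] /andP[YT _]; apply: disT.
have T2g : (#|T2| <=
    #|[set g in placements | placed_edges g \subset edges G]|)%N.
  (* The single vertex [g x0] identifies the tile containing it, so distinct tiles get distinct
     placements. *)
  pose r2 (X : {set V} * {set {set V}}) (g : {ffun W -> V}) := g x0 \in X.1.
  apply: (leq_card_rel (r := r2)) => [X|X Y g].
    rewrite inE => /andP[XT Xdis].
    have /andP[/andP[Xsub Xin]] := Tcopy _ XT.
    case/existsP => f /and3P[/injectiveP finj /eqP X1 /eqP X2].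
    pose g : {ffun W -> V} := [ffun x => if x \in S.1 then f x else y0].
    have gS : {in S.1, g =1 f} by move=> x xS; rewrite ffunE xS.
    exists g; last by rewrite /r2 gS // X1 imset_f ?inE.
    rewrite inE; apply/andP; split.
      rewrite inE; apply/andP; split.
        apply/pffun_onP; split => // ; apply/fintype.subsetP => x.
        by rewrite inE ffunE; case: (x \in S.1) => //; rewrite eqxx.
      by apply/dinjectiveP => x y xS yS; rewrite !gS // => /finj.
    apply/fintype.subsetP => _ /imsetP[e eS ->].
    have -> : g @: e = f @: e.
      apply: eq_in_imset => x xe; apply: gS.
      exact: (fintype.subsetP (subgraph_edge_sub eS)).
    have feX : f @: e \in X.2.
      case/andP: (subS) => /fintype.subsetP sub _.
      by rewrite X2; apply: imset_f; exact: sub.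
    (* An edge of a tile that avoids [A] cannot come from the hitting graph. *)
    have := fintype.subsetP Xsub _ feX; rewrite !inE => /orP[/andP[_]|//].
    by rewrite (disjointWl (forall_inP Xin _ feX) Xdis).
  by rewrite !inE => /andP[XT _] /andP[YT _]; apply: disT.
have Tle : (#|T| <= #|T1| + #|T2|)%N.
  have -> : T = T1 :|: T2.
    by apply/finset.setP => X; rewrite !inE -andb_orr orNb andbT.
  by case: (leq_card_setU T1 T2).
have -> : #|V| = #|\bigcup_(X in T) X.1| by rewrite Tcov cardsT.
have : (#|\bigcup_(X in T) X.1| <= \sum_(X in T) #|X.1|)%N.
  elim/big_rec2: _ => [|X k B _ IH]; first by rewrite cards0.
  by rewrite (leq_trans (leq_card_setU _ _)) // leq_add2l.
have -> : (\sum_(X in T) #|X.1| = #|W| * #|T|)%N.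
  rewrite mulnC -sum_nat_const; apply: eq_bigr => X XT.
  have /andP[_ /existsP[f /and3P[/injectiveP finj /eqP -> _]]] := Tcopy _ XT.
  by rewrite card_imset // cardsT.
by move/leq_trans; apply; rewrite leq_mul2l (leq_trans Tle) ?orbT // leq_add.
Qed.

End Placements.

(** * A densest subgraph and the expected number of its placements *)

Lemma dstar_attained (R : realType) (W : finType) (H : sgraph W) :
  (0 < #|edges H|)%N ->
  exists S, [/\ subgraph H S, (1 < #|S.1|)%N, (0 < #|S.2|)%N,
    0 < dstar R H & #|S.2|%:R = dstar R H * #|S.1|.-1%:R].
Proof.
(* A single edge has density 1, so the maximum is positive and the default 0 is harmless. *)
case/card_gt0P => e eH; pose S0 := ([set x in e], [set e]).
have e2 := eqP (forall_inP (card_edge H) e eH).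
have S0P : subgraph H S0 && (1 < #|S0.1|)%N.
  rewrite /subgraph /S0 /= finset.sub1set eH cardsE e2 andbT /=.
  by apply/forall_inP => _ /set1P ->; apply/fintype.subsetP => x; rewrite inE.
have den0 (S : {set W} * {set {set W}}) : subgraph H S && (1 < #|S.1|)%N ->
    0 <= density R S.
  by case/andP=> _ S1; rewrite divr_ge0 // subr_ge0 ler1n ltnW.
have [S SP dS] := Order.TotalTheory.eq_bigmax S0 _ (density R) S0P den0.
have d0 : 0 < dstar R H.
  apply: (lt_le_trans _ (le_bigmax_cond 0 (density R) S0P)).
  by rewrite /density /S0 /= cardsE e2 cards1 divr_gt0 // subr_gt0 ltr1n.
rewrite -/(dstar R H) in dS.
case/andP: SP => subS S1.
have dSE : #|S.2|%:R = dstar R H * #|S.1|.-1%:R.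
  rewrite dS /density -subn1 natrB ?(ltnW S1) // divfK //.
  by rewrite gt_eqF // subr_gt0 ltr1n.
exists S; split=> //.
rewrite -(ltr0n R) dSE mulr_gt0 // ltr0n.
by case: #|S.1| S1 => [|[]].
Qed.

(** As [k / d = v - 1], the bound on [p] gives [p ^+ k <= q ^+ k / n ^+ (v - 1)], and [q ^+ k <= q]
    because [k > 0] and [q <= 1]. *)
Lemma expected_placements_le (R : realType) (d p q : R) (n v k : nat) :
  (0 < n)%N -> (0 < v)%N -> (0 < k)%N -> 0 < d -> k%:R = d * v.-1%:R ->
  0 <= q <= 1 -> 0 <= p -> p <= q * n%:R `^ (- d^-1) ->
  (n ^ v)%:R * p ^+ k <= q * n%:R.
Proof.
move=> n0 v0 k0 d0 kE /andP[q0 q1] p0 ple.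
have pw0 : 0 <= n%:R `^ (- d^-1) :> R by exact: powR_ge0.
have : p ^+ k <= (q * n%:R `^ (- d^-1)) ^+ k.
  by apply: lerXn2r; rewrite ?nnegrE ?mulr_ge0.
rewrite exprMn -[X in _ <= _ * X]powR_mulrn // -powRrM mulNr kE.
rewrite mulKf ?gt_eqF //.
rewrite powRN powR_mulrn // => pk.
apply: le_trans (ler_wpM2l _ pk) _ => //.
rewrite natrX mulrCA -{1}(prednK v0) exprS -mulrA divff ?mulr1; last first.
  by rewrite expf_neq0 // pnatr_eq0 -lt0n.
rewrite ler_wpM2r //; case: k k0 {kE pk} => // k _; rewrite exprS ler_piMr //.
exact: exprn_ile1.
Qed.

(** * The choice of the graphs and the limit *)

Lemma card_ord_lt (n k : nat) : (k <= n)%N -> #|[set i : 'I_n | (i < k)%N]| = k.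
Proof.
move=> kn; rewrite -sum1dep_card (big_ord_narrow kn).
by rewrite sum1_card card_ord.
Qed.

(** Rounding half of [n %/ h] up gives the minimum degree bound even when [n = h]. *)
Definition seed_set (h n : nat) : {set 'I_n} :=
  [set i : 'I_n | (i < uphalf (n %/ h))%N].

Lemma card_seed_set (h n : nat) : #|seed_set h n| = uphalf (n %/ h).
Proof.
apply: card_ord_lt; apply: leq_trans (leq_div n h).
by rewrite uphalf_half -[leqRHS]odd_double_half leq_add2l -addnn leq_addr.
Qed.

Lemma card_vertices_gt1 (W : finType) (H : sgraph W) :
  (0 < #|edges H|)%N -> (1 < #|W|)%N.
Proof.
case/card_gt0P => e eH; rewrite -(eqP (forall_inP (card_edge H) e eH)).
exact: max_card.
Qed.

Lemma Gnp_prob_tiling_le (R : realType) (W : finType) (H : sgraph W)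
    (n : nat) (p q : R) :
  (0 < #|edges H|)%N -> (#|W| %| n)%N -> (2 * #|W| <= n)%N ->
  0 <= q <= 1 -> 0 <= p <= 1 -> p <= q * n%:R `^ (- (dstar R H)^-1) ->
  Gnp_prob p [pred G' | has_perfect_tiling H
    (gunion (hitting_graph (seed_set #|W| n)) G')] <= 4 * #|W|%:R * q.
Proof.
move=> eH hn n2h q01 p01 ple; have h1 := card_vertices_gt1 eH.
have h0 : (0 < #|W|)%N by exact: ltnW.
have n0 : (0 < n)%N by apply: leq_trans n2h; rewrite muln_gt0.
have [S [subS S1 S2 d0 dS]] := dstar_attained R eH.
have [x0 x0S] : exists x0, x0 \in S.1 by apply/card_gt0P/ltnW.
pose y0 : 'I_n := Ordinal n0; set B := [pred G' | _].
pose m := (n %/ #|W|)%N.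
have nE : (n = #|W| * m)%N by rewrite mulnC divnK.
have m2 : (1 < m)%N by rewrite leq_divRL.
(* Of the [m] tiles, at most [uphalf m] meet the seed set, which leaves [m./2]. *)
have counted G : B G -> (m./2 <= #|[set g in placements S y0 |
    placed_edges S g \subset edges G]|)%N.
  move=> /(tiling_placements y0 subS x0S).
  rewrite card_ord {1}nE leq_pmul2l // card_seed_set -/m.
  by rewrite -leq_subLR -{1}(odd_double_half m) uphalf_half -addnn addnA addKn.
have := Gnp_prob_markov p01 (@placed_edge_card2 _ _ H S y0 subS)
  (@card_placed_edges _ _ H S y0 subS) counted.
have := expected_placements_le n0 (ltnW S1) S2 d0 dS q01 (andP p01).1 ple.
move=> le1 le2.
have : m./2%:R * Gnp_prob p B <= q * n%:R.
  apply: le_trans le2 (le_trans _ le1).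
  rewrite ler_wpM2r ?exprn_ge0 ?(andP p01).1 // ler_nat.
  by apply: leq_trans (card_placements S y0) _; rewrite card_ord.
have mh0 : 0 < m./2%:R :> R by rewrite ltr0n half_gt0.
(* This crude bound needs [m > 1], which makes [m./2] positive. *)
have mh : m%:R <= 4 * m./2%:R :> R.
  rewrite -natrM ler_nat; have := odd_double_half m; move: m2.
  by case: (odd m); lia.
move=> le3; rewrite -(ler_pM2l mh0); apply: le_trans le3 _.
rewrite {1}nE natrM; have /andP[q0 _] := q01.
have -> : m./2%:R * (4 * #|W|%:R * q) = (q * #|W|%:R) * (4 * m./2%:R) by ring.
by rewrite mulrA ler_wpM2l // mulr_ge0.
Qed.

Local Open Scope classical_set_scope.
Local Open Scope ring_scope.

Theorem mainTheorem2 (R : realType) (W : finType) (H : sgraph W)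
    (H_edge : (0 < #|edges H|)%N) :
  exists alpha : R, 0 < alpha /\
  exists G : forall n : nat, sgraph 'I_n,
    (forall n : nat, (0 < n)%N -> (#|W| %| n)%N ->
       alpha * n%:R <= (min_degree (G n))%:R) /\
    (forall p : nat -> R,
       (forall n : nat, (0 < n)%N -> (#|W| %| n)%N -> 0 <= p n <= 1) ->
       p =o_ (multiples #|W|) (fun n : nat => n%:R `^ (- (dstar R H)^-1)) ->
       Gnp_prob (p n)
         [pred G' | ~~ has_perfect_tiling H (gunion (G n) G')]
         @[n --> multiples #|W|] --> (1 : R)).
Proof.
have h1 := card_vertices_gt1 H_edge.
have h0 : 0 < #|W|%:R :> R by rewrite ltr0n ltnW.
exists (2 * #|W|%:R)^-1; split; first by rewrite invr_gt0 mulr_gt0.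
exists (fun n => hitting_graph (seed_set #|W| n)); split=> [n n0 hn|p p01 po].
  have nE : (n = #|W| * (n %/ #|W|))%N by rewrite mulnC divnK.
  have m0 : (0 < n %/ #|W|)%N by rewrite divn_gt0 ?(ltnW h1) // dvdn_leq.
  have mE := odd_double_half (n %/ #|W|).
  have := uphalf_half (n %/ #|W|); set u := uphalf _ => uE.
  (* Strict because [#|W| >= 2], so that [n] is at least twice [n %/ #|W|]. *)
  have un : (u < n)%N.
    have : (2 * (n %/ #|W|) <= n)%N by rewrite {2}nE leq_mul2r h1 orbT.
    by move: m0 mE uE; case: (odd _); lia.
  have := @hitting_graph_min_degree _ (seed_set #|W| n).
  rewrite card_ord card_seed_set -/u => /(_ un) deg.
  apply: (@le_trans _ _ u%:R); last by rewrite ler_nat.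
  rewrite ler_pdivrMl ?mulr_gt0 // -!natrM ler_nat {1}nE -mulnA mulnCA.
  rewrite leq_mul2l; apply/orP; right.
  by move: m0 mE uE; case: (odd _); lia.
apply/cvgrPdist_le => eps eps0.
(* The second term turns the bound [4 * #|W| * q] into [eps]; the cap 1 is required by the
   first-moment estimate. *)
pose q : R := Num.min 1 (eps / (4 * #|W|%:R)).
have c0 : 0 < 4 * #|W|%:R :> R by rewrite mulr_gt0.
have q0 : 0 < q by rewrite lt_min ltr01 divr_gt0.
have q1 : q <= 1 by rewrite ge_min lexx.
have qeps : 4 * #|W|%:R * q <= eps.
  by rewrite -ler_pdivlMl // mulrC ge_min lexx orbT.
have near_dvd : \forall n \near multiples #|W|, (#|W| %| n)%N.
  exact: withinT.
have near_large : \forall n \near multiples #|W|, (2 * #|W| <= n)%N.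
  by apply: cvg_within; exact: nbhs_infty_ge.
have near_p := (eqoP _ _ _).1 po q q0.
near=> n.
have hn : (#|W| %| n)%N by near: n.
have n2h : (2 * #|W| <= n)%N by near: n.
have n0 : (0 < n)%N by apply: leq_trans n2h; rewrite muln_gt0 /= ltnW.
have pn01 := p01 n n0 hn.
have ple : p n <= q * n%:R `^ (- (dstar R H)^-1).
  (* The little-o hypothesis compares norms, so norms are inserted on both sides. *)
  rewrite -[leRHS](@ger0_norm _ (_ * _)) ?mulr_ge0 ?powR_ge0 ?(ltW q0) //.
  apply: le_trans (ler_norm _) _; rewrite normrM (gtr0_norm q0).
  by near: n.
rewrite (Gnp_probC (p n) [pred G' | has_perfect_tiling H
  (gunion (hitting_graph (seed_set #|W| n)) G')]).
rewrite opprB addrCA subrr addr0 ger0_norm ?Gnp_prob_ge0 //.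
apply: le_trans qeps; apply: Gnp_prob_tiling_le => //.
by rewrite (ltW q0).
Unshelve. all: by end_near.
Qed.
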